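(* Let $\beta<-\frac23$. There exists a constant $C_\beta$ such that for every integer $n\ge1$, if $n$ is divisible by $3$ or $n\ge C_\beta$, then global synchronization does not occur in the system on $\mathbb{T}^n$ $$\dot x_i(t)=-\sum_{j=1}^n e^{\beta\cos(x_i(t)-x_j(t))}\sin(x_i(t)-x_j(t)),\qquad 1\le i\le n,$$ and global synchronization does not occur in the system on $\mathbb{T}^n$ $$\dot x_i(t)=-\frac{1}{\sum_{j=1}^n e^{\beta\cos(x_i(t)-x_j(t))}}\sum_{j=1}^n e^{\beta\cos(x_i(t)-x_j(t))}\sin(x_i(t)-x_j(t)),\qquad 1\le i\le n.$$
   Context: $\mathbb{T}=\mathbb{R}/2\pi\mathbb{Z}$. For a system of ODEs on $\mathbb{T}^n$, synchronization occurs for a starting point $(x_i(0))_{1\le i\le n}\in\mathbb{T}^n$ if there is $x^*\in\mathbb{T}$ with $\lim_{t\to\infty}x_i(t)=x^*$ for all $i$; global synchronization occurs if synchronization occurs for almost every starting point with respect to the volume measure on $\mathbb{T}^n$. *)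

(* Defs.v *)
From HB Require Import structures.
From mathcomp Require Import all_boot all_order all_algebra.
From mathcomp Require Import all_classical all_reals all_analysis.

Set Implicit Arguments.
Unset Strict Implicit.
Unset Printing Implicit Defensive.

Import Order.TTheory GRing.Theory Num.Theory.
Import numFieldNormedType.Exports.

Local Open Scope classical_set_scope.
Local Open Scope ring_scope.
Local Open Scope quotient_scope.

Section circle.
Variable R : realType.

Definition same_angle (x y : R) : bool := (x - y) / (2 * pi) \is a Num.int.

Lemma same_angle_equiv : equiv_class_of same_angle.
Proof.
split=> [x|x y|y x z]; rewrite /same_angle.
- by rewrite subrr mul0r rpred0.
- by rewrite -opprB mulNr rpredN.
- move=> xy yz; rewrite -(subrKA y) mulrDl; exact: rpredD.
Qed.

Canonical same_angle_equiv_rel := EquivRelPack same_angle_equiv.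

(* R / 2 pi Z, with the quotient topology and its Borel sigma-algebra. *)
Definition circle := quotient_topology {eq_quot same_angle}.

HB.instance Definition _ := Pointed.on circle.
HB.instance Definition _ := Topological.on circle.
HB.instance Definition _ := Quotient.on circle.

HB.instance Definition _ := @isMeasurable.Build default_measure_display circle
  (<<s @open circle >>) (@sigma_algebra0 _ _ _) (@sigma_algebraC _ _)
  (@sigma_algebra_bigcup _ _ _).

Definition angle (x : R) : circle := \pi_circle x.

Lemma angleP (x y : R) :
  angle x = angle y <-> (x - y) / (2 * pi) \is a Num.int.
Proof. by split=> [/eqmodP|h]; [|apply/eqmodP]. Qed.

Lemma measurable_angle : measurable_fun setT angle.
Proof.
apply: (@measurability _ _ _ _ _ _ (@open circle)) => //.
move=> _ [U oU <-]; rewrite setTI.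
apply: measurable_realfun.open_measurable; exact: oU.
Qed.

HB.instance Definition _ := isMeasurableFun.Build _ _ _ _ angle measurable_angle.


(* `[0, 2 * pi[ is a fundamental domain, so this is the length measure of
   R / 2 pi Z, of total mass 2 pi (arclength_setT). *)
Definition arclength (A : set circle) : \bar R :=
  lebesgue_measure ((angle @^-1` A) `&` `[0, 2 * pi[%classic).

Let arclengthE : arclength =
  pushforward (mrestr lebesgue_measure (measurable_itv `[0 : R, 2 * pi[)) angle.
Proof. by []. Qed.

Let arclength0 : arclength set0 = 0%E.
Proof. by rewrite /arclength preimage_set0 set0I measure0. Qed.

Let arclength_ge0 A : (0 <= arclength A)%E.
Proof. exact: measure_ge0. Qed.

Let arclength_semi_sigma_additive : semi_sigma_additive arclength.
Proof.
move=> F mF tF mUF; rewrite arclengthE.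
exact: (@measure_semi_sigma_additive _ _ _
  (measure_function_pushforward__canonical__measure_function_Measure
     (mrestr lebesgue_measure (measurable_itv `[0 : R, 2 * pi[))
     measurable_angle)).
Qed.

HB.instance Definition _ := isMeasure.Build _ _ _ arclength
  arclength0 arclength_ge0 arclength_semi_sigma_additive.

Lemma arclength_setT : arclength setT = (2 * pi)%:E.
Proof.
rewrite /arclength preimage_setT setTI lebesgue_measure_itv/= lte_fin.
by rewrite mulr_gt0 ?pi_gt0// oppr0 adde0.
Qed.

Let arclength_fin : fin_num_fun arclength.
Proof.
apply: lty_fin_num_fun.
by have /= -> := arclength_setT; rewrite ltry.
Qed.

HB.instance Definition _ := Measure_isFinite.Build _ _ _ arclength
  arclength_fin.

End circle.

Section torus_volume.
Variable R : realType.

Definition torus_cons n (z : circle R * n.-tuple (circle R)) :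
  n.+1.-tuple (circle R) := [tuple of z.1 :: z.2].

Lemma measurable_torus_cons n : measurable_fun setT (@torus_cons n).
Proof. exact: measurable_cons. Qed.

Section step.
Variables (n : nat) (mu : {finite_measure set (n.-tuple (circle R)) -> \bar R}).

Definition torus_step (A : set (n.+1.-tuple (circle R))) : \bar R :=
  (@arclength R \x mu)%E (@torus_cons n @^-1` A).

Let torus_step0 : torus_step set0 = 0%E.
Proof. by rewrite /torus_step preimage_set0 measure0. Qed.

Let torus_step_ge0 A : (0 <= torus_step A)%E.
Proof. exact: measure_ge0. Qed.

Let torus_step_semi_sigma_additive : semi_sigma_additive torus_step.
Proof.
exact: (@measure_semi_sigma_additive _ _ _
  (measure_function_pushforward__canonical__measure_function_Measure
     (@arclength R \x mu)%E (@measurable_torus_cons n))).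
Qed.

HB.instance Definition _ := isMeasure.Build _ _ _ torus_step
  torus_step0 torus_step_ge0 torus_step_semi_sigma_additive.

Let torus_step_fin : fin_num_fun torus_step.
Proof.
suff : (torus_step setT < +oo)%E by exact: lty_fin_num_fun.
rewrite (_ : torus_step _ = (@arclength R \x mu)%E (setT `*` setT)); last first.
  by rewrite setXTT.
rewrite product_measure1E//.
apply: lte_mul_pinfty => //.
  exact: fin_num_measure.
by rewrite ltey_eq fin_num_measure.
Qed.

HB.instance Definition _ := Measure_isFinite.Build _ _ _ torus_step
  torus_step_fin.

End step.

(* The n-fold product of arclength, on the product sigma-algebra of n-tuples;
   see torus_volume_box. *)
Fixpoint torus_volume n : {finite_measure set (n.-tuple (circle R)) -> \bar R} :=
  match n with
  | 0 => \d_([tuple] : 0.-tuple (circle R))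
  | n.+1 => torus_step (torus_volume n)
  end.

Lemma torus_volume_box n (A : 'I_n -> set (circle R)) :
  (forall i, measurable (A i)) ->
  torus_volume n [set p | forall i, A i (tnth p i)] =
  (\prod_(i < n) arclength (A i))%E.
Proof.
elim: n => [|n IH] in A * => mA.
  rewrite big_ord0 /= diracE mem_set//=.
  by case.
rewrite big_ord_recl -IH; last by move=> i; exact: mA.
rewrite /= /torus_step; set B := (X in _ = (_ * _ X)%E).
rewrite (_ : _ @^-1` _ = A ord0 `*` B).
  apply: product_measure1E => //.
  rewrite [B](_ : _ = \bigcap_(i in [set: 'I_n])
    ((@tnth n _ ^~ i) @^-1` A (lift ord0 i))).
    apply: fin_bigcap_measurable => // i _.
    by rewrite -[X in measurable X]setTI; exact: measurable_tnth.
  by apply/seteqP; split=> [p + i _|p + i]; [exact|move/(_ i I)].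
apply/seteqP; split=> -[x p] /=.
  move=> h; split=> [|i]; first exact: (h ord0).
  by have := h (lift ord0 i); rewrite /= tnthS.
move=> [h0 h] i; case: (unliftP ord0 i) => [j ->|->//].
by rewrite tnthS; exact: h.
Qed.

End torus_volume.

Section dynamics.
Variables (R : realType) (n : nat).

(* A curve x in T^n solves x' = V x on [0, +oo[ when some continuous lift theta
   of x to R^n does. The field V is given on R^n in the coordinates of the lift;
   it defines a field on T^n when it is 2 pi-periodic in each coordinate, as
   both fields below are. At t = 0 only continuity is required, which for a
   continuous V gives the one-sided derivative there. *)
Definition torus_solution (V : ('I_n -> R) -> 'I_n -> R)
    (x : R -> n.-tuple (circle R)) : Prop :=
  exists theta : R -> 'I_n -> R,
    [/\ forall (t : R) i, 0 <= t -> tnth (x t) i = angle (theta t i),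
        forall i, {within `[0, +oo[, continuous (fun t : R => theta t i)} &
        forall (t : R) i, 0 < t ->
          is_derive t 1 (fun s => theta s i) (V (theta t) i)].

(* Both fields below are smooth on the compact T^n, so each starting point has
   exactly one solution on [0, +oo[ and the existential over x denotes the
   trajectory started at p. *)
Definition synchronizes (V : ('I_n -> R) -> 'I_n -> R)
    (p : n.-tuple (circle R)) : Prop :=
  exists2 x : R -> n.-tuple (circle R),
    torus_solution V x /\ x 0 = p &
    exists xs : circle R, forall i, tnth (x t) i @[t --> +oo%R] --> xs.

Definition global_synchronization (V : ('I_n -> R) -> 'I_n -> R) : Prop :=
  {ae torus_volume R n, forall p, synchronizes V p}.

Definition unnormalized_field (beta : R) (x : 'I_n -> R) (i : 'I_n) : R :=
  - \sum_(j < n) expR (beta * cos (x i - x j)) * sin (x i - x j).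

Definition normalized_field (beta : R) (x : 'I_n -> R) (i : 'I_n) : R :=
  - ((\sum_(j < n) expR (beta * cos (x i - x j)))^-1 *
     \sum_(j < n) expR (beta * cos (x i - x j)) * sin (x i - x j)).

End dynamics.

(* Main.v *)
Require Import Defs.
From mathcomp Require Import all_boot all_order all_algebra.
From mathcomp Require Import all_classical all_reals all_analysis.
From mathcomp Require Import zify ring lra.

Import Order.TTheory GRing.Theory Num.Theory.
Import numFieldNormedType.Exports.
Local Open Scope classical_set_scope.
Local Open Scope ring_scope.

Set Implicit Arguments.
Unset Strict Implicit.
Unset Printing Implicit Defensive.

(** Put the oscillators into three clusters, oscillator [i] going to the cluster
    of [i] modulo 3, centred at three points of the circle at mutual distance
    [2 pi / 3]. The interaction is [f x = expR (beta * cos x) * sin x], with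
    [f' x = expR (beta * cos x) * (cos x - beta * sin x ^ 2)]. Within a cluster
    the slope is [f' 0 > 0]; between clusters it is a positive multiple of
    [- 1 / 2 - 3 beta / 4], which is positive exactly when [beta < - 2 / 3]
    ([coupling_slope_third]). So near the three-cluster configuration every pair
    attracts, relatively to its place in the configuration, with strength at
    least some [kappa] up to some displacement [eta] ([coupling_gain]).

    Let [dev i] be the displacement of oscillator [i] from its cluster centre,
    in a continuous lift. If the spread of the [dev i] is exactly [eta], the
    oscillator with the largest displacement and the one with the smallest
    approach each other: attraction contributes [- n * kappa * eta] to the
    derivative of the difference, up to the positive weights of the normalized
    field. The drift caused by unequal cluster sizes vanishes if 3 divides [n]
    and is bounded independently of [n] in any case ([sum_offset_le]), hence it
    loses as soon as [n] is large. By the first-exit argument [barrier] the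
    spread therefore stays below [eta] forever ([spread_trapped]), and the
    clusters stay apart. This holds for every solution whose initial
    displacements are below [eta / 2]; such starting points form a product of
    arcs, which has positive volume ([not_global_synchronization]). *)

(** * Differential inequalities on the real line *)

Section real_line.
Variable R : realType.
Implicit Types (f : R -> R) (x k d : R).

(** The difference quotient exceeds [k] on a punctured neighbourhood of [x];
    evaluating it at [h] and at [- h] gives both inequalities. *)
Lemma is_derive_gt_near f x d k : is_derive x 1 f d -> k < d ->
  \forall h \near (0 : R), 0 <= h ->
    f x + k * h <= f (x + h) /\ f (x - h) <= f x - k * h.
Proof.
move=> [dfx <-] kd.
have : \forall h \near 0^', k < h^-1 *: (f (h *: 1 + x) - f x).
  exact: (cvgr_gt _ dfx).
rewrite near_withinE.
move=> /nbhs_ballP[e /= e0 near_slope]; apply/nbhs_ballP; exists e => //= h.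
rewrite /ball/= sub0r normrN => he; rewrite le_eqVlt => /predU1P[<-|h0].
  by rewrite mulr0 !subr0 !addr0.
have := near_slope (- h); have := near_slope h.
rewrite /ball/= !sub0r !normrN => /(_ he) + /(_ he).
rewrite oppr_eq0 gt_eqF// => /(_ isT) + /(_ isT).
rewrite /GRing.scale/= !mulr1 invrN mulNr ![_ + x]addrC.
rewrite -mulrN !ltr_pdivlMl// => hp hm.
by split; lra.
Qed.

(** Look at the first time some [phi a] reaches [eta]: it is positive, no
    member exceeds [eta] there, and the one that has reached [eta] was larger
    just before because its derivative is negative. *)
Lemma barrier (I : finType) (phi : I -> R -> R) (eta : R) :
  (forall a, {within `[0, +oo[, continuous (phi a)}) ->
  (forall a, phi a 0 < eta) ->
  (forall t, 0 < t -> (forall a, phi a t <= eta) ->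
    forall a, phi a t = eta -> exists2 d, d < 0 & is_derive t 1 (phi a) d) ->
  forall t, 0 <= t -> forall a, phi a t < eta.
Proof.
move=> cphi phi0 dphi t t0 a; rewrite ltNge; apply/negP => phit.
pose S := [set s | 0 <= s /\ exists b, eta <= phi b s].
have S0 : S !=set0 by exists t; split=> //; exists a.
have lbS : lbound S 0 by move=> s [].
have infS : has_inf S by split=> //; exists 0.
pose T := inf S.
have T0 : 0 <= T by exact: lb_le_inf.
have before s b : 0 <= s -> s < T -> phi b s < eta.
  move=> s0 sT; rewrite ltNge; apply/negP => phis.
  have : T <= s by apply: ge_inf; [exists 0|split=> //; exists b].
  by rewrite leNgt sT.
have {}cphi b : phi b s @[s --> within `[0, +oo[ (nbhs T)] --> phi b T.
  by move/subspace_continuousP : (cphi b); apply; rewrite /= in_itv/= T0.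
have [c phicT] : exists c, eta <= phi c T.
  apply: contrapT => /forallNP noT.
  have : \forall s \near within `[0, +oo[ (nbhs T), forall b, phi b s < eta.
    apply: filter_forall => b; apply: (cvgr_lt _ (cphi b)).
    by rewrite ltNge; apply/negP.
  move=> /nbhs_ballP[e /= e0 near_lt].
  have [s [s0 [b phis]] sT] := inf_adherent e0 infS.
  have Ts : T <= s by apply: ge_inf; [exists 0|split=> //; exists b].
  have /(_ _ _)/(_ b) := near_lt s; rewrite ltNge phis /=.
  rewrite /ball/= distrC ger0_norm ?subr_ge0// ltrBlDl in_itv/= s0.
  by move=> /(_ sT isT).
have {}T0 : 0 < T.
  rewrite lt_neqAle T0 andbT; apply/eqP => T_eq0.
  by move: phicT; rewrite -T_eq0 leNgt phi0.
have step e : 0 < e -> exists h : R, [/\ 0 < h, h < e & h < T].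
  move=> e0; exists (Num.min e T / 2).
  have m0 : 0 < Num.min e T by rewrite lt_min e0.
  have [me mT] : Num.min e T <= e /\ Num.min e T <= T.
    by rewrite !ge_min !lexx orbT.
  by split; lra.
have phiT b : phi b T <= eta.
  rewrite leNgt; apply/negP => phibT.
  have : \forall s \near within `[0, +oo[ (nbhs T), eta < phi b s.
    exact: (cvgr_gt _ (cphi b)).
  move=> /nbhs_ballP[e /= e0 near_gt]; have [h [h0 he hT]] := step e e0.
  have Th0 : 0 <= T - h by lra.
  have /(_ _ _) := near_gt (T - h).
  rewrite /ball/= in_itv/= Th0 subKr gtr0_norm// he.
  move=> /(_ isT isT); rewrite ltNge => /negP; apply; apply/ltW/before => //.
  by lra.
have phicT_eq : phi c T = eta by apply/eqP; rewrite eq_le phiT.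
have [d d0 dphic] := dphi T T0 phiT c phicT_eq.
have k_lt : - (d / 2) < - d by lra.
have := is_derive_gt_near (is_deriveN dphic) k_lt.
move=> /nbhs_ballP[e /= e0 near_T].
have [h [h0 h_lt hT]] := step e e0.
have he : ball (0 : R) e h by rewrite /ball/= sub0r normrN gtr0_norm.
have [_ past] : _ /\ - phi c (T - h) <= - phi c T - - (d / 2) * h :=
  near_T h he (ltW h0).
have : phi c (T - h) < eta by apply: before; lra.
have : 0 < - d * h by rewrite mulr_gt0// oppr_gt0.
rewrite phicT_eq in past; move: past; rewrite mulNr; lra.
Qed.

End real_line.

(** * The interaction function *)

Section coupling.
Variable R : realType.
Implicit Types (beta x y u : R) (k : int).

Lemma cosD2piz x k : cos (x + 2 * pi * k%:~R) = cos x.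
Proof.
have per y n : cos (y + 2 * pi * n%:R) = cos y.
  rewrite -[RHS](periodicn (@cosD2pi R) n); congr (cos (_ + _)).
  by rewrite mulr_natr [2 * pi]mulr_natl.
case: k => n; first exact: per.
by rewrite -[LHS](per _ n.+1) NegzE mulrNz mulrN subrK.
Qed.

Lemma sinD2piz x k : sin (x + 2 * pi * k%:~R) = sin x.
Proof. by rewrite -[LHS]cosBpihalf addrAC cosD2piz cosBpihalf. Qed.

Definition third : R := 2 * pi / 3.

Lemma third_gt0 : 0 < third.
Proof. by rewrite divr_gt0// mulr_gt0// pi_gt0. Qed.

(** Doubling [2 pi / 3] gives its opposite modulo [2 pi], so its cosine [c]
    satisfies [2 c ^ 2 - 1 = c], and [c = 1] is excluded. *)
Lemma cos_third : cos third = - 2^-1.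
Proof.
have /eqP : cos (third + third) = cos third.
  rewrite -[RHS]cosN -(cosD2piz (- third) 1); congr cos.
  by rewrite /third; lra.
rewrite cosD -!expr2 sin2cos2 => /eqP c2.
have c1 : cos third != 1.
  rewrite -(cos0 R) (inj_in_eq (@cos_inj R)) ?in_itv/=.
  - by rewrite gt_eqF// /third; have := pi_gt0 R; lra.
  - by rewrite /third; have := pi_gt0 R; lra.
  - by rewrite lexx pi_ge0.
apply: (@mulIf _ (cos third - 1)); first by rewrite subr_eq0.
by lra.
Qed.

Lemma cos_thirdz k : cos (third * k%:~R) = 1 \/ cos (third * k%:~R) = - 2^-1.
Proof.
have -> : third * k%:~R =
    third * (k %% 3)%Z%:~R + 2 * pi * (k %/ 3)%Z%:~R.
  rewrite {1}(divz_eq k 3) intrD intrM /third; lra.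
rewrite cosD2piz.
have := modz_ge0 k (isT : (3 : int) != 0).
have := ltz_pmod k (isT : 0 < (3 : int)).
case: (k %% 3)%Z => [[|[|[|]]]|]//= _ _.
- by left; rewrite mulr0 cos0.
- by right; rewrite mulr1 cos_third.
- right; rewrite -cos_third -[RHS]cosN -(cosD2piz (- third) 1); congr cos.
  by rewrite /third; lra.
Qed.

Definition coupling beta x : R := expR (beta * cos x) * sin x.

Lemma couplingD2piz beta x k :
  coupling beta (x + 2 * pi * k%:~R) = coupling beta x.
Proof. by rewrite /coupling cosD2piz sinD2piz. Qed.

Lemma couplingN beta x : coupling beta (- x) = - coupling beta x.
Proof. by rewrite /coupling cosN sinN mulrN. Qed.

Lemma normr_coupling_le beta x : `|coupling beta x| <= expR `|beta|.
Proof.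
rewrite normrM gtr0_norm ?expR_gt0// -[leRHS]mulr1.
apply: ler_pM; rewrite ?expR_ge0// ?ler_norml ?sin_geN1 ?sin_le1//.
rewrite ler_expR (le_trans (ler_norm _))// normrM ler_piMr//.
by rewrite ler_norml cos_geN1 cos_le1.
Qed.

Lemma is_derive_coupling beta x : is_derive x 1 (coupling beta)
  (expR (beta * cos x) * (cos x - beta * sin x ^+ 2)).
Proof.
rewrite /coupling.
have dcos : is_derive x 1 (fun y => beta * cos y) (beta * - sin x).
  exact: (is_deriveZ beta (is_derive_cos x)).
have dexp := @is_derive1_comp _ expR (fun y => beta * cos y) _ _ _
  (is_derive_expR _) dcos.
apply: is_derive_eq (is_deriveM dexp (is_derive_sin x)) _.
rewrite /GRing.scale/=; ring.
Qed.

(** The only cosines at multiples of [2 pi / 3] are [1] and [- 1 / 2]; at the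
    latter the second factor is [- 1 / 2 - 3 / 4 * beta], the origin of the
    threshold [- 2 / 3]. *)
Lemma coupling_slope_third beta k : beta < - (2 / 3) ->
  0 < expR (beta * cos (third * k%:~R)) *
      (cos (third * k%:~R) - beta * sin (third * k%:~R) ^+ 2).
Proof.
move=> hbeta; rewrite mulr_gt0 ?expR_gt0// sin2cos2.
by case: (cos_thirdz k) => ->; lra.
Qed.

(** The equilibrium phase difference of oscillators [i] and [j], each placed in
    the cluster of its index modulo 3. *)
Definition offset (i j : nat) : R :=
  third * ((i %% 3)%N%:Z - (j %% 3)%N%:Z)%:~R.

Lemma offset_modl i j : offset (i %% 3) j = offset i j.
Proof. by rewrite /offset modn_mod. Qed.

Lemma offset_modr i j : offset i (j %% 3) = offset i j.
Proof. by rewrite /offset modn_mod. Qed.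

(** There are only nine pairs of residues, each with a positive slope, so half
    the least slope serves as [kappa] and one neighbourhood suits all of them.
    The bound on [eta] keeps displaced clusters well separated. *)
Lemma coupling_gain beta : beta < - (2 / 3) ->
  exists eta kappa : R, [/\ 0 < eta, eta <= third / 4, 0 < kappa &
    forall i j u, 0 <= u -> u <= eta ->
      coupling beta (offset i j) + kappa * u <= coupling beta (offset i j + u)
      /\
      coupling beta (offset i j - u) <= coupling beta (offset i j) - kappa * u].
Proof.
move=> hbeta.
pose c (a : 'I_3 * 'I_3) := offset a.1 a.2.
pose slope a := expR (beta * cos (c a)) * (cos (c a) - beta * sin (c a) ^+ 2).
have slope0 a : 0 < slope a by exact: coupling_slope_third.
have [kappa kappa0 kappa_lt] : exists2 kappa, 0 < kappa &
    forall a, kappa < slope a.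
  pose a0 : 'I_3 * 'I_3 := (ord0, ord0).
  pose am := [arg min_(a < a0) slope a]%O.
  exists (slope am / 2); first by rewrite divr_gt0.
  move=> a; rewrite (@lt_le_trans _ _ (slope am))//.
    by have := slope0 am; lra.
  by rewrite /am; case: arg_minP => // i _; exact.
pose gain a u := 0 <= u ->
  coupling beta (c a) + kappa * u <= coupling beta (c a + u) /\
  coupling beta (c a - u) <= coupling beta (c a) - kappa * u.
have : \forall u \near (0 : R), forall a, gain a u.
  apply: (@filter_forall R _ gain (nbhs (0 : R))) => a.
  exact: is_derive_gt_near (is_derive_coupling _ _) (kappa_lt a).
move=> /nbhs_ballP[e /= e0 near_gain].
have m0 : 0 < Num.min e third by rewrite lt_min e0 third_gt0.
have [me mT] : Num.min e third <= e /\ Num.min e third <= third.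
  by rewrite !ge_min !lexx orbT.
exists (Num.min e third / 4), kappa; split => //; [lra|lra|].
move=> i j u u0 ue.
have <- : c (inord (i %% 3), inord (j %% 3)) = offset i j.
  by rewrite /c /= !inordK ?ltn_pmod// offset_modl offset_modr.
apply: (near_gain u) => //.
by rewrite /ball/= sub0r normrN ger0_norm//; lra.
Qed.

(** The three terms are, in some order, the values of the odd function
    [coupling beta] at [0], [third] and [- third] modulo [2 pi]: the clusters of
    an equally divided population balance. *)
Lemma coupling_period_sum beta k :
  coupling beta (third * k%:~R) + coupling beta (third * k%:~R - third) +
  coupling beta (third * k%:~R - third - third) = 0.
Proof.
have f0 : coupling beta 0 = 0 by rewrite /coupling sin0 mulr0.
have f2 : coupling beta (third + third) = - coupling beta third.
  rewrite -couplingN -(couplingD2piz beta (- third) 1); congr coupling.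
  by rewrite /third; lra.
have -> : third * k%:~R =
    third * (k %% 3)%Z%:~R + 2 * pi * (k %/ 3)%Z%:~R.
  rewrite {1}(divz_eq k 3) intrD intrM /third; lra.
rewrite ![_ + 2 * pi * _ - _]addrAC !couplingD2piz.
have := modz_ge0 k (isT : (3 : int) != 0).
have := ltz_pmod k (isT : 0 < (3 : int)).
case: (k %% 3)%Z => [[|[|[|]]]|]//= _ _.
- rewrite mulr0 f0 sub0r -opprD !couplingN f2; lra.
- rewrite mulr1 subrr f0 sub0r couplingN; lra.
- rewrite (_ : third * _ = third + third); last by rewrite -mulr2n mulr_natr.
  by rewrite f2 addrK subrr f0; lra.
Qed.

(** Three consecutive indices contribute nothing by [coupling_period_sum], so
    only an incomplete last block of at most two terms survives. *)
Lemma sum_offset_le beta i n :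
  `|\sum_(j < n) coupling beta (offset i j)| <=
    if (3 %| n)%N then 0 else 2 * expR `|beta|.
Proof.
pose r := (i %% 3)%N.
pose h j := coupling beta (third * (r%:Z - j%:Z)%:~R).
have hmod j : coupling beta (offset i j) = h j.
  rewrite /h /offset -/r -[LHS](couplingD2piz _ _ (- (j %/ 3)%N%:Z)).
  congr coupling.
  have -> : r%:Z - j%:Z = r%:Z - (j %% 3)%N%:Z - 3 * (j %/ 3)%N%:Z by lia.
  by rewrite !intrD !intrN intrM /third; lra.
under eq_bigr do rewrite hmod.
have h3 j : h j + h j.+1 + h j.+2 = 0.
  rewrite -[RHS](coupling_period_sum beta (r%:Z - j%:Z)) /h.
  congr (_ + coupling _ _ + coupling _ _).
  - have -> : r%:Z - j.+1%:Z = r%:Z - j%:Z - 1 by lia.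
    by rewrite intrD mulrDr mulrN1.
  - have -> : r%:Z - j.+2%:Z = r%:Z - j%:Z - 1 - 1 by lia.
    by rewrite !intrD !mulrDr !mulrN1.
have hle j : `|h j| <= expR `|beta| by exact: normr_coupling_le.
have drop_blocks q m : \sum_(j < m + q * 3) h j = \sum_(j < m) h j.
  elim: q => [|q IHq]; first by rewrite mul0n addn0.
  rewrite mulSnr addnA addn3 !big_ord_recr/= IHq -!addrA [h _ + (_ + _)]addrA.
  by rewrite h3 addr0.
have -> : \sum_(j < n) h j = \sum_(j < n %% 3) h j.
  by rewrite -(drop_blocks (n %/ 3)%N (n %% 3)%N) addnC -divn_eq.
have := ltn_pmod n (isT : (0 < 3)%N); rewrite /dvdn.
case: (n %% 3)%N => [|[|[|]]]// _.
- by rewrite big_ord0 normr0.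
- rewrite big_ord1 (le_trans (hle _))//=.
  by have := expR_ge0 `|beta|; lra.
- rewrite !big_ord_recr big_ord0/= add0r (le_trans (ler_normD _ _))//.
  by have := hle 0%N; have := hle 1%N; lra.
Qed.

End coupling.

(** * Arcs of the circle *)

Section circle_arcs.
Variable R : realType.
Implicit Types (x y r : R).

Lemma angle_eqP x y :
  angle x = angle y <-> exists k : int, x = y + 2 * pi * k%:~R.
Proof.
have pi2 : 2 * pi != 0 :> R by rewrite mulf_neq0// gt_eqF// pi_gt0.
rewrite angleP; split => [/intrP[k ek]|[k ->]].
  by exists k; rewrite -ek mulrC divfK// addrC subrK.
by rewrite addrAC subrr add0r mulrAC mulfV// mul1r intr_int.
Qed.

Definition arc x r : set (circle R) :=
  [set z | exists2 y, angle y = z & `|y - x| < r].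

Lemma open_arc x r : open (arc x r).
Proof.
suff : open (@angle R @^-1` arc x r) by [].
rewrite openE => y [y' yy' y'x]; apply/nbhs_ballP.
exists (r - `|y' - x|) => /=; first by rewrite subr_gt0.
move=> z; rewrite /ball/= => yz.
have [k yk] := (angle_eqP y' y).1 yy'.
exists (z + 2 * pi * k%:~R); first by apply/angle_eqP; exists k.
rewrite (_ : _ - x = (y' - x) - (y - z)); last by rewrite yk; lra.
by rewrite (le_lt_trans (ler_normB _ _))// -ltrBrDl.
Qed.

Lemma measurable_arc x r : measurable (arc x r).
Proof.
suff : <<s @open (circle R) >> (arc x r) by [].
by apply: sub_sigma_algebra; exact: open_arc.
Qed.

Lemma arclength_arc_gt0 x r : 0 < r -> 0 <= x - r -> x + r <= 2 * pi ->
  (0 < arclength (arc x r))%E.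
Proof.
move=> r0 x0 x1; rewrite /arclength.
apply: (@lt_le_trans _ _ (lebesgue_measure `]x - r, x + r[%classic)).
  by rewrite lebesgue_measure_itv/= lte_fin -EFinB ifT ?lte_fin; lra.
apply: le_measure; rewrite ?inE.
- exact: measurable_itv.
- apply: measurableI; last exact: measurable_itv.
  by rewrite -[X in measurable X]setTI; apply: measurable_angle => //;
    exact: measurable_arc.
- move=> y /=; rewrite in_itv/= => /andP[y0 y1]; split.
    by exists y => //; rewrite ltr_norml; lra.
  by rewrite in_itv/=; lra.
Qed.

End circle_arcs.

(** * The trapping region *)

Section trapping.
Variables (R : realType) (n : nat) (beta eta kappa a K : R).
Variables (V w : ('I_n -> R) -> 'I_n -> R).
(* The weight [w] covers both fields: constant for the unnormalized one, the
   inverse total weight for the normalized one. Only the ratio [K] of its bounds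
   enters the competition between drift and attraction. *)
Hypothesis V_eq : forall x i,
  V x i = - (w x i * \sum_(j < n) coupling beta (x i - x j)).
Hypothesis a_gt0 : 0 < a.
Hypothesis w_bounds : forall x i, a <= w x i <= K * a.
Hypothesis gain : forall i j u, 0 <= u -> u <= eta ->
  coupling beta (offset R i j) + kappa * u <= coupling beta (offset R i j + u)
  /\ coupling beta (offset R i j - u) <= coupling beta (offset R i j) - kappa * u.
Hypothesis kappa_gt0 : 0 < kappa.
(* Bounds the drift due to clusters of unequal sizes. *)
Let defect : R := if (3 %| n)%N then 0 else 2 * expR `|beta|.
Hypothesis defect_lt : 2 * K * defect < n%:R * kappa * eta.

(** The shift by [pi / 3] keeps small arcs around the three centres inside the
    fundamental domain between [0] and [2 pi]. *)
Definition phase (i : nat) : R := third R * (i %% 3)%N%:R + pi / 3.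

Let phaseB i j : phase i - phase j = offset R i j.
Proof. by rewrite /phase /offset intrB; lra. Qed.

Section solution.
Variables (theta : R -> 'I_n -> R) (turn : 'I_n -> int).
Hypothesis theta_cont :
  forall i, {within `[0, +oo[, continuous (fun t : R => theta t i)}.
Hypothesis theta_deriv : forall (t : R) i, 0 < t ->
  is_derive t 1 (fun s => theta s i) (V (theta t) i).

Let dev i t : R := theta t i - (phase i + 2 * pi * (turn i)%:~R).

Let coupling_dev i j t : coupling beta (theta t i - theta t j) =
  coupling beta (offset R i j + (dev i t - dev j t)).
Proof.
rewrite -[RHS](couplingD2piz _ _ (turn i - turn j)); congr coupling.
by rewrite /dev -phaseB intrB; lra.
Qed.

(* When [i] and [k] realize the spread, all differences [dev i t - dev j t] and
   [dev j t - dev k t] lie between [0] and [eta], where the one-sided estimates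
   of [gain] apply. The two differences add up to [eta] for each [j], so the
   total attraction is [n * kappa * eta] up to the weights, whatever the position
   of the other oscillators. *)
Let spread_decreases t i k :
  (forall j l, dev j t - dev l t <= eta) -> dev i t - dev k t = eta ->
  V (theta t) i - V (theta t) k < 0.
Proof.
move=> small eik.
have above j : 0 <= dev i t - dev j t <= eta.
  by have := small j k; have := small i j; lra.
have below j : 0 <= dev j t - dev k t <= eta.
  by have := small i j; have := small j k; lra.
have defect0 : 0 <= defect.
  by rewrite /defect; case: ifP => // _; rewrite mulr_ge0 ?expR_ge0.
have := sum_offset_le beta i n; rewrite -/defect ler_norml => /andP[Fi _].
have := sum_offset_le beta k n; rewrite -/defect ler_norml => /andP[_ Fk].
set P := \sum_(j < n) (dev i t - dev j t).
set Q := \sum_(j < n) (dev j t - dev k t).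
have PQ : P + Q = n%:R * eta.
  rewrite -big_split/= (eq_bigr (fun=> eta)) => [|j _]; last by rewrite -eik; lra.
  by rewrite big_const_ord iter_addr_0 mulr_natl.
have P0 : 0 <= P by apply: sumr_ge0 => j _; case/andP: (above j).
have Q0 : 0 <= Q by apply: sumr_ge0 => j _; case/andP: (below j).
have Si : - defect + kappa * P <= \sum_(j < n) coupling beta (theta t i - theta t j).
  apply: (@le_trans _ _
    (\sum_(j < n) coupling beta (offset R i j) + kappa * P)); first by lra.
  rewrite mulr_sumr -big_split/=; apply: ler_sum => j _; rewrite coupling_dev.
  by case/andP: (above j) => u0 ue; case: (gain i j u0 ue).
have Sk : \sum_(j < n) coupling beta (theta t k - theta t j) <= defect - kappa * Q.
  apply: (@le_trans _ _
    (\sum_(j < n) coupling beta (offset R k j) - kappa * Q)); last by lra.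
  rewrite mulr_sumr -sumrB; apply: ler_sum => j _; rewrite coupling_dev.
  case/andP: (below j) => u0 ue; case: (gain k j u0 ue) => _.
  by rewrite opprB.
rewrite !V_eq.
move: Si Sk; set Si := (\sum_(j < n) _); set Sk := (\sum_(j < n) _) => Si_ge Sk_le.
have wS (u S D : R) : a <= u <= K * a -> 0 <= D ->
    - defect + kappa * D <= S -> a * (kappa * D) - K * a * defect <= u * S.
  move=> /andP[u1 u2] D0 SD.
  have u0 : 0 <= u := le_trans (ltW a_gt0) u1.
  apply: (le_trans _ (ler_wpM2l u0 SD)).
  have kD : 0 <= kappa * D by rewrite mulr_ge0// ltW.
  have := ler_wpM2r kD u1; have := ler_wpM2r defect0 u2; lra.
have := wS _ _ _ (w_bounds (theta t) i) P0 Si_ge.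
have Sk_ge : - defect + kappa * Q <= - Sk by lra.
have := wS _ _ _ (w_bounds (theta t) k) Q0 Sk_ge.
have := defect_lt; rewrite -(ltr_pM2l a_gt0).
have -> : n%:R * kappa * eta = kappa * (P + Q) by rewrite PQ; lra.
rewrite mulrN; nra.
Qed.

(** [barrier] for the family of all differences [dev i - dev j]: one of them
    equal to [eta] while none exceeds it realizes the spread, and then
    [spread_decreases] gives the sign of its derivative. *)
Lemma spread_trapped : (forall i, `|dev i 0| < eta / 2) ->
  forall t, 0 <= t -> forall i j, dev i t - dev j t < eta.
Proof.
move=> dev0 t t0 i j.
pose phi (p : 'I_n * 'I_n) s := dev p.1 s - dev p.2 s.
apply: (@barrier R _ phi eta _ _ _ t t0 (i, j)) => [p|p|s s0 small p pe].
- move=> s; apply: cvgB; apply: cvgB; try exact: cvg_cst; exact: theta_cont.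
- by have := dev0 p.1; have := dev0 p.2; rewrite /phi !ltr_norml; lra.
- exists (V (theta s) p.1 - V (theta s) p.2).
    by apply: spread_decreases => // l m; exact: (small (l, m)).
  have dd l : is_derive s 1 (dev l) (V (theta s) l).
    rewrite -[X in is_derive _ _ _ X]subr0.
    exact: is_deriveB (theta_deriv l s0) (is_derive_cst _ _ _).
  exact: is_deriveB (dd p.1) (dd p.2).
Qed.

End solution.

Hypothesis eta_gt0 : 0 < eta.
Hypothesis eta_le : eta <= third R / 4.
Hypothesis n_gt1 : (1 < n)%N.

(** If all oscillators converged to [xs], those of indices 0 and 1 would
    eventually be closer than [third / 4], whereas trapping keeps their lifted
    difference within [third / 4] of [- third] modulo [2 pi]. Then some integer
    multiple of [2 pi] would lie strictly between [0] and [2 pi]. *)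
Lemma not_synchronizes (p : n.-tuple (circle R)) :
  (forall i : 'I_n, arc (phase i) (eta / 2) (tnth p i)) -> ~ synchronizes V p.
Proof.
move=> near_phase [x [[theta [lift cont deriv]] x0p] [xs cvg_xs]].
have turn_ex (i : 'I_n) : exists k : int,
    `|theta 0 i - (phase i + 2 * pi * k%:~R)| < eta / 2.
  have [y yp y_near] := near_phase i.
  have /angle_eqP[k k_eq] : angle (theta 0 i) = angle y by rewrite -lift// x0p.
  exists k; rewrite k_eq (_ : _ - _ = y - phase i)//; lra.
have [turn turn_near] := choice turn_ex.
have third0 := third_gt0 R.
have trapped := spread_trapped cont deriv turn_near.
pose i0 : 'I_n := Ordinal (ltnW n_gt1); pose i1 : 'I_n := Ordinal n_gt1.
have [z zE] : exists z : R, angle z = xs by exists (repr xs); exact: reprK.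
have nbhs_arc : nbhs xs (arc z (third R / 8)).
  apply: open_nbhs_nbhs; split; first exact: open_arc.
  by exists z => //; rewrite subrr normr0 divr_gt0.
have xs_near (i : 'I_n) :
    \forall t \near +oo%R, arc z (third R / 8) (tnth (x t) i).
  exact: (cvg_xs i _ nbhs_arc).
near (pinfty_nbhs R) => t.
have t0 : 0 <= t by near: t; exact: nbhs_pinfty_ge.
have [y0 + y0_near] : arc z (third R / 8) (tnth (x t) i0) by near: t.
have [y1 + y1_near] : arc z (third R / 8) (tnth (x t) i1) by near: t.
rewrite !lift// => /esym/angle_eqP[k1 k1_eq] /esym/angle_eqP[k0 k0_eq].
pose m := k1 - k0 - (turn i1 - turn i0).
have t01 := trapped t t0 i0 i1; have t10 := trapped t t0 i1 i0.
have m_eq : 2 * pi * m%:~R = 3 * third R * m%:~R by rewrite /third; lra.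
have : 0 < 3 * third R * m%:~R < 3 * third R.
  have pi3 : pi = 3 / 2 * third R :> R by rewrite /third; lra.
  move: t01 t10 y0_near y1_near; rewrite !ltr_norml -m_eq /m !intrB.
  rewrite k0_eq k1_eq /phase /= mulr0 mulr1.
  move: (third R) third0 eta_le => c c0 eta_le_c *; lra.
have c0 : 0 < 3 * third R by rewrite mulr_gt0.
rewrite (pmulr_rgt0 _ c0) => /andP[m_gt0]; rewrite -[ltRHS]mulr1 ltr_pM2l//.
by rewrite ltrz1 ltNge -gtz0_ge1 -(ltr0z R) m_gt0.
Unshelve. all: by end_near. Qed.

(** The arcs around the phases form a box of non-synchronizing starting points,
    and its volume is the product of their lengths. *)
Lemma not_global_synchronization : ~ global_synchronization V.
Proof.
pose A (i : 'I_n) := arc (phase i) (eta / 2).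
have mA i : measurable (A i) by exact: measurable_arc.
have A_gt0 i : (0 < arclength (A i))%E.
  have third0 := third_gt0 R.
  have pi3 : pi = 3 / 2 * third R :> R by rewrite /third; lra.
  have i3 : 0 <= ((i %% 3)%N%:R : R) <= 2.
    by rewrite ler0n -[2]/(2%:R) ler_nat -ltnS ltn_pmod.
  apply: arclength_arc_gt0; first by rewrite divr_gt0.
    by rewrite /phase pi3; move: (third R) third0 eta_le => c c0 ?; nra.
  by rewrite /phase pi3; move: (third R) third0 eta_le => c c0 ?; nra.
move=> /negligibleS sync0.
have : torus_volume R n [set p | forall i, A i (tnth p i)] = 0%E.
  apply: measure_negligible.
    rewrite (_ : [set p | _] =
        \bigcap_(i in [set: 'I_n]) ((@tnth n _ ^~ i) @^-1` A i)).
      apply: fin_bigcap_measurable => // i _.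
      by rewrite -[X in measurable X]setTI; exact: measurable_tnth.
    by apply/seteqP; split=> [p + i _|p + i]; [exact|move/(_ i I)].
  by apply: sync0 => p; exact: not_synchronizes.
rewrite torus_volume_box// => /eqP; apply/negP; rewrite gt_eqF//.
by elim/big_ind : _ => // x y x0 y0; exact: mule_gt0.
Qed.

End trapping.

(** * The two fields *)

Section fields.
Variable R : realType.

Lemma unnormalized_fieldE n beta (x : 'I_n -> R) i :
  unnormalized_field beta x i =
  - (1 * \sum_(j < n) coupling beta (x i - x j)).
Proof. by rewrite mul1r. Qed.

Definition total_weight n beta (x : 'I_n -> R) i : R :=
  \sum_(j < n) expR (beta * cos (x i - x j)).

Lemma total_weight_bounds n beta (x : 'I_n -> R) i :
  n%:R * expR (- `|beta|) <= total_weight beta x i <= n%:R * expR `|beta|.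
Proof.
have le_beta y : `|beta * cos y| <= `|beta|.
  by rewrite normrM ler_piMr// ler_norml cos_geN1 cos_le1.
have nE (c : R) : n%:R * c = \sum_(j < n) c.
  by rewrite sumr_const card_ord mulr_natl.
rewrite !nE.
apply/andP; split; apply: ler_sum => j _; rewrite ler_expR.
  by rewrite lerNl (le_trans _ (le_beta (x i - x j)))// -normrN ler_norm.
exact: le_trans (ler_norm _) (le_beta _).
Qed.

End fields.

Theorem corollary2p6 (R : realType) (beta : R) (beta_lt : beta < - (2 / 3)) :
  exists C : R, forall n : nat, (1 <= n)%N ->
    (3 %| n)%N \/ C <= n%:R ->
    ~ global_synchronization (@unnormalized_field R n beta) /\
    ~ global_synchronization (@normalized_field R n beta).
Proof.
have [eta [kappa [eta0 eta_le kappa0 gain]]] := coupling_gain beta_lt.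
(* Total weights lie between [n / E] and [n * E], so [K] bounds their ratio. *)
pose E := expR `|beta|; pose K := E * E.
have E1 : 1 <= E by rewrite -expR0 ler_expR.
have K1 : 1 <= K by rewrite /K; nra.
pose C := 4 * K * E / (kappa * eta) + 2.
have ke0 : 0 < kappa * eta by rewrite mulr_gt0.
have C2 : 2 < C.
  by rewrite ltrDr divr_gt0// !mulr_gt0//; lra.
(* The first summand makes attraction beat the drift; the second one provides
   two nonempty clusters. *)
exists C => n n_ge1 n_large.
have n_gt1 : (1 < n)%N.
  case: n_large => [/(dvdn_leq n_ge1)|Cn]; first exact: ltn_trans.
  by rewrite -(ltr_nat R); lra.
have n0 : 0 < n%:R :> R by rewrite ltr0n.
have defect_lt :
    2 * K * (if (3 %| n)%N then 0 else 2 * E) < n%:R * kappa * eta.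
  case: ifPn n_large => [_ _|_ [//|Cn]]; first by rewrite mulr0 -mulrA mulr_gt0.
  rewrite -[ltRHS]mulrA -ltr_pdivrMr//; apply: lt_le_trans Cn.
  by rewrite /C (_ : 2 * K * (2 * E) = 4 * K * E); lra.
split.
  apply: (@not_global_synchronization R n beta eta kappa 1 K _ (fun _ _ => 1)
    (@unnormalized_fieldE R n beta)) => //.
  by move=> _ _; rewrite lexx mulr1.
have EN : expR (- `|beta|) = E^-1 by rewrite expRN.
(* The inverse weights lie between [1 / (n * E)] and [E / n], of ratio [K]. *)
apply: (@not_global_synchronization R n beta eta kappa (n%:R * E)^-1 K _
  (fun x i => (total_weight beta x i)^-1)) => //.
  by rewrite invr_gt0 mulr_gt0//; lra.
move=> x i; have := total_weight_bounds beta x i; rewrite EN => /andP[W1 W2].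
have E0 : 0 < E by lra.
have W0 : 0 < total_weight beta x i.
  by apply: lt_le_trans W1; rewrite divr_gt0.
rewrite lef_pV2 ?posrE ?mulr_gt0// W2/=.
rewrite (_ : K * _ = (n%:R / E)^-1); last by rewrite /K; field; rewrite !gt_eqF.
by rewrite lef_pV2 ?posrE ?divr_gt0.
Qed.
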